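(* Consider an alcove $\Delta$ with integer characteristics $(m_{i,j})$, an index $a\in\{1,\dots,n-1\}$, and $I\in\mathcal I_\lambda$ such that $a\in I_k$, $a+1\in I_l$. Let $s_{a,a+1}(z)=(z_1,\dots,z_{a-1},z_{a+1},z_a,z_{a+2},\dots,z_n)$. If $k=l$, then $W^\Delta_I(t,s_{a,a+1}(z),h)=W^\Delta_I(t,z,h)$. If $k<l$, then $$W^\Delta_{s_{a,a+1}(I)}(t,z,h)=\frac{1-hz_a/z_{a+1}}{1-z_a/z_{a+1}}\,W^\Delta_I(t,s_{a,a+1}(z),h)+(h-1)\frac{(z_a/z_{a+1})^{m_{k,l}+1}}{1-z_a/z_{a+1}}\,W^\Delta_I(t,z,h).$$ If $k>l$, then $$W^\Delta_{s_{a,a+1}(I)}(t,z,h)=\frac{1-h^{-1}z_{a+1}/z_a}{1-z_{a+1}/z_a}\,W^\Delta_I(t,s_{a,a+1}(z),h)+(h^{-1}-1)\frac{(z_{a+1}/z_a)^{m_{l,k}+1}}{1-z_{a+1}/z_a}\,W^\Delta_I(t,z,h).$$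
   Context: Fix positive integers $n,N$ and $\lambda=(\lambda_1,\dots,\lambda_N)\in\mathbb Z_{\ge0}^N$ with $\sum_k\lambda_k=n$. Put $\lambda^{(k)}=\lambda_1+\dots+\lambda_k$, $\lambda^{\{1\}}=\lambda^{(1)}+\dots+\lambda^{(N-1)}$. $\mathcal I_\lambda$ is the set of ordered partitions $I=(I_1,\dots,I_N)$ of $\{1,\dots,n\}$ with $|I_k|=\lambda_k$; write $\bigcup_{j\le k}I_j=\{i^{(k)}_1<\dots<i^{(k)}_{\lambda^{(k)}}\}$. $s_{a,a+1}(I)$ is obtained from $I$ by exchanging the numbers $a$ and $a+1$. Alcoves are the connected components of the complement in $\mathbb R^N$ of all hyperplanes $\nu_j-\nu_i=m$, $1\le i<j\le N$, $m\in\mathbb Z$. The integer characteristics of $\Delta$ are $m_{i,j}=\lfloor\nu_j-\nu_i\rfloor$ ($i<j$), for any $\nu\in\Delta$. Trigonometric weight functions: variables $t=(t^{(k)}_a)$, $1\le k\le N-1$, $1\le a\le\lambda^{(k)}$; $z=(z_1,\dots,z_n)$ with $t^{(N)}_a=z_a$; and $h$. $$W^\Delta_I(t,z,h)=(1-h)^{\lambda^{\{1\}}}\operatorname{Sym}_{t^{(1)}}\cdots\operatorname{Sym}_{t^{(N-1)}}\prod_{k=1}^{N-1}\prod_{a=1}^{\lambda^{(k)}}\Big(\prod_{c=1}^{\lambda^{(k+1)}}\psi^\Delta_{I,k,a,c}(t^{(k+1)}_c/t^{(k)}_a)\prod_{b=a+1}^{\lambda^{(k)}}\frac{1-ht^{(k)}_b/t^{(k)}_a}{1-t^{(k)}_b/t^{(k)}_a}\Big),$$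 where $\operatorname{Sym}_{t^{(k)}}$ is the sum over all permutations of $t^{(k)}_1,\dots,t^{(k)}_{\lambda^{(k)}}$, and $\psi^\Delta_{I,k,a,c}(x)$ equals $1-hx$ if $i^{(k+1)}_c<i^{(k)}_a$, equals $x^{-m_{j,k+1}}$ with $j$ defined by $i^{(k)}_a\in I_j$ if $i^{(k+1)}_c=i^{(k)}_a$, and equals $1-x$ if $i^{(k+1)}_c>i^{(k)}_a$. *)

(* Defs.v *)
From HB Require Import structures.
From mathcomp Require Import all_boot all_order all_fingroup all_algebra.
From mathcomp Require Import all_classical all_reals all_analysis.

Set Implicit Arguments.
Unset Strict Implicit.
Unset Printing Implicit Defensive.

Import Order.TTheory GRing.Theory Num.Theory.
Import numFieldNormedType.Exports.

Local Open Scope classical_set_scope.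
Local Open Scope ring_scope.

(** Parts I_1, ..., I_N and elements 1, ..., n are the ordinals of 'I_N and 'I_n
    shifted by one.  Levels k of the variables t^(k) and of the sums lambda^(k)
    are NOT shifted: level k involves the parts I_1, ..., I_k, i.e. the ordinals
    j < k.  Hence an ordinal k : 'I_N with 0 < k stands for the level k, and used
    as a part it stands for I_(k+1). *)

(** * Alcoves *)

Definition wall_complement (R : realType) (N : nat) : set 'rV[R]_N :=
  [set nu | forall i j : 'I_N, (i < j)%N -> forall m : int,
     nu ord0 j - nu ord0 i != m%:~R].
Arguments wall_complement : clear implicits.

Definition is_alcove (R : realType) (N : nat) (Delta : set 'rV[R]_N) : Prop :=
  exists2 nu, wall_complement R N nu &
    Delta = connected_component (wall_complement R N) nu.

(** Computed at a chosen point; int_charE shows that any point of an alcove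
    gives the same value. *)
Definition int_char (R : realType) (N : nat) (Delta : set 'rV[R]_N)
    (i j : 'I_N) : int :=
  let nu := xget 0 Delta in Num.floor (nu ord0 j - nu ord0 i).

Lemma alcove_sub (R : realType) (N : nat) (Delta : set 'rV[R]_N) :
  is_alcove Delta -> Delta `<=` wall_complement R N.
Proof. by move=> [nu _ ->]; exact: connected_component_sub. Qed.

Lemma alcove_floor (R : realType) (N : nat) (Delta : set 'rV[R]_N)
    (i j : 'I_N) (nu mu : 'rV[R]_N) :
  is_alcove Delta -> (i < j)%N -> Delta nu -> Delta mu ->
  Num.floor (nu ord0 j - nu ord0 i) <= Num.floor (mu ord0 j - mu ord0 i).
Proof.
move=> aD ij Dnu Dmu; rewrite leNgt; apply/negP => lt_fl.
pose g (x : 'rV[R]_N) : R := x ord0 j - x ord0 i.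
have cg : continuous g.
  move=> x; have cj := @coord_continuous R 1 N ord0 j x.
  exact: (continuousB cj (@coord_continuous R 1 N ord0 i x)).
have ctD : connected Delta.
  by case: aD => ? _ ->; exact: component_connected.
have /connected_intervalP itvD : connected (g @` Delta).
  by apply: connected_continuous_connected => //; exact: continuous_subspaceT.
have /= [] := itvD (g mu) (g nu) _ _ (Num.floor (g nu))%:~R.
- by exists mu.
- by exists nu.
- by rewrite floor_le andbT ltW// -floor_lt_int.
move=> x Dx /eqP gx.
by have := alcove_sub aD Dx ij (Num.floor (g nu)); rewrite gx.
Qed.

Lemma int_charE (R : realType) (N : nat) (Delta : set 'rV[R]_N)
    (i j : 'I_N) (nu : 'rV[R]_N) :
  is_alcove Delta -> (i < j)%N -> Delta nu ->
  int_char Delta i j = Num.floor (nu ord0 j - nu ord0 i).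
Proof.
move=> aD ij Dnu; rewrite /int_char.
have Dx : Delta (xget 0 Delta) by apply: xgetPex; exists nu.
by apply/eqP; rewrite eq_le !(alcove_floor aD ij).
Qed.

Local Close Scope classical_set_scope.

(** * Ordered partitions *)

Definition lamc (N : nat) (lam : 'I_N -> nat) (k : nat) : nat :=
  (\sum_(j < N | (j < k)%N) lam j)%N.

Definition lamtot (N : nat) (lam : 'I_N -> nat) : nat :=
  (\sum_(k < N | (0 < k)%N) lamc lam k)%N.

Definition is_ordered_partition (n N : nat) (lam : 'I_N -> nat)
    (I : 'I_N -> {set 'I_n}) : Prop :=
  [/\ forall k, #|I k| = lam k,
      forall k l, k != l -> [disjoint I k & I l] &
      (\bigcup_k I k)%SET = [set: 'I_n]%SET].

(** [ith I k a] is i^(k)_(a+1); [enum] of a set of ordinals is increasing.  The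
    default ord0 is not used for a < lambda^(k). *)
Definition ith (n N : nat) (I : 'I_N -> {set 'I_n.+1}) (k a : nat) : 'I_n.+1 :=
  nth ord0 (enum (\bigcup_(j < N | (j < k)%N) I j)%SET) a.

(** [swap a b] with b = a + 1 is s_(a,a+1), on partitions and on z. *)
Definition swap_part (n N : nat) (a b : 'I_n) (I : 'I_N -> {set 'I_n}) :
    'I_N -> {set 'I_n} :=
  fun k => [set tperm a b i | i in I k]%SET.

Definition swap_var (F : Type) (n : nat) (a b : 'I_n) (z : 'I_n -> F) :
    'I_n -> F :=
  fun i => z (tperm a b i).

(** * Weight functions *)

(** The variables t^(k)_a, 1 <= k <= N-1, 1 <= a <= lambda^(k), valued in F (for
    variables in the usual sense, take for F a field of rational functions).
    Since lambda^(0) = 0, level 0 carries no variable. *)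
Definition tvars (F : Type) (N : nat) (lam : 'I_N -> nat) : Type :=
  forall k : 'I_N, 'I_(lamc lam k) -> F.

(** The variable t^(k)_(a+1) for 1 <= k <= N, with t^(N) = z.  The value 0 is
    used only for indices out of range. *)
Definition tz (F : fieldType) (n N : nat) (lam : 'I_N -> nat)
    (t : tvars F lam) (z : 'I_n -> F) (k a : nat) : F :=
  if insub k is Some k' then oapp (t k') 0 (insub a) else oapp z 0 (insub a).

Definition Sym_tvar (F : fieldType) (N : nat) (lam : 'I_N -> nat) (k : 'I_N)
    (f : tvars F lam -> F) : tvars F lam -> F :=
  fun t => \sum_(s : 'S_(lamc lam k)) f (dfwith t k (fun a => t k (s a))).

(** Sym_{t^(1)} ... Sym_{t^(N-1)} *)
Definition Sym_tvars (F : fieldType) (N : nat) (lam : 'I_N -> nat)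
    (f : tvars F lam -> F) : tvars F lam -> F :=
  foldr (@Sym_tvar F N lam) f [seq k : 'I_N <- enum 'I_N | (0 < k)%N].

Definition psi (R : realType) (F : fieldType) (n N : nat)
    (Delta : set 'rV[R]_N) (I : 'I_N -> {set 'I_n.+1}) (h : F)
    (k : 'I_N) (a c : nat) (x : F) : F :=
  let ia := ith I k a in
  let ic := ith I k.+1 c in
  if (ic < ia)%N then 1 - h * x
  else if ic == ia then
    if [pick j | ia \in I j] is Some j then x ^ (- int_char Delta j k) else 1
  else 1 - x.

Definition weight_term (R : realType) (F : fieldType) (n N : nat)
    (lam : 'I_N -> nat) (Delta : set 'rV[R]_N) (I : 'I_N -> {set 'I_n.+1})
    (z : 'I_n.+1 -> F) (h : F) (t : tvars F lam) : F :=
  \prod_(k < N | (0 < k)%N) \prod_(a < lamc lam k)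
    ((\prod_(c < lamc lam k.+1)
        psi Delta I h k a c (tz t z k.+1 c / tz t z k a)) *
     (\prod_(b < lamc lam k | (a < b)%N)
        ((1 - h * (tz t z k b / tz t z k a)) /
         (1 - tz t z k b / tz t z k a)))).

Definition weight (R : realType) (F : fieldType) (n N : nat)
    (lam : 'I_N -> nat) (Delta : set 'rV[R]_N) (I : 'I_N -> {set 'I_n.+1})
    (t : tvars F lam) (z : 'I_n.+1 -> F) (h : F) : F :=
  (1 - h) ^+ lamtot lam * Sym_tvars (weight_term Delta I z h) t.

(* Main.v *)
Require Import Defs.
From HB Require Import structures.
From mathcomp Require Import all_boot all_order all_fingroup all_algebra.
From mathcomp Require Import all_classical all_reals all_analysis.
From mathcomp Require Import ring zify.

(** Symmetrize level by level: let G_j(w) be the sum, over the permutations of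
    t^(1), ..., t^(j-1), of the factors of the levels below j, where the
    variables of level j are set to w; the weight function is a multiple of
    G_N(z).  Assume a in I_k, a + 1 in I_l.

    If k < l, exchanging a and a + 1 in I does not change G_j for j <= l (no level
    sees both numbers, so the relative order is kept).  At the level where a + 1
    appears, the exchange relation is a rational identity for that one factor.
    From there it is carried upwards: the permutations s and s o (i1 i2), where i1
    and i2 are the positions of a and a + 1, are grouped together, everything but
    four factors is symmetric in both pairs of variables, and what is left is a
    rational identity; it holds because m_{k,j} - m_{k,l} - m_{l,j} is 0 or 1.
    If k = l, the same grouping carries the symmetry of G_j upwards.

    If k > l, apply the case k < l to s(I), at z and at s(z), and eliminate
    W_{s(I)}(s(z)): this only inverts a determinant, which equals h. *)

Set Implicit Arguments.
Unset Strict Implicit.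
Unset Printing Implicit Defensive.

Import Order.TTheory GRing.Theory Num.Theory.

Local Open Scope ring_scope.

(** * The factors of one level *)

(** The factor psi in terms of the numbers attached to its row and its column. The exponent is a
    parameter, so the exchange identities below involve neither a partition nor an alcove. *)
Definition psi_at (F : fieldType) (n : nat) (h : F) (r c : 'I_n) (e : int) (x : F) : F :=
  if (c < r)%N then 1 - h * x else if c == r then x ^ e else 1 - x.

Lemma psi_at_eq (F : fieldType) (n : nat) (h : F) (r r' c c' : 'I_n) (e e' : int) (x : F) :
  (c < r)%N = (c' < r')%N -> (c == r) = (c' == r') -> (c == r -> e = e') ->
  psi_at h r c e x = psi_at h r' c' e' x.
Proof.
rewrite /psi_at => -> <- ee; case: ifP => // _.
by case: ifP => // cr; rewrite ee.
Qed.

(** Since b = a + 1, a and b compare alike with any third number. The exponent is read only when row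
    and column agree; for a row in {a, b} the first condition excludes this, so exponents are
    compared for the other rows only. *)
Lemma psi_at_swap (F : fieldType) (n : nat) (h : F) (a b r r' c c' : 'I_n) (e e' : int) (x : F) :
  b = a.+1 :> nat -> ~~ ((r \in pred2 a b) && (c \in pred2 a b)) ->
  r' = r \/ r' = tperm a b r -> c' = c \/ c' = tperm a b c ->
  (r \notin pred2 a b -> e = e') -> psi_at h r' c' e' x = psi_at h r c e x.
Proof.
move=> ab Hrc Hr Hc He.
have [rS|rnS] := boolP (r \in pred2 a b).
  move: Hrc; rewrite rS /= => cS.
  have Ec : c' = c.
    case: Hc => // ->; rewrite inE /= negb_or in cS; case/andP: cS => ca cb.
    by rewrite tpermD // eq_sym.
  rewrite {c' Hc}Ec; move: rS cS; rewrite !inE !negb_or => rS /andP[].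
  rewrite -!val_eqE /= => ca cb.
  have r'S : r' = a \/ r' = b.
    by case: Hr => ->; case/orP: rS => /eqP ->; rewrite ?tpermL ?tpermR; tauto.
  have rS' : r = a \/ r = b by case/orP: rS => /eqP ->; tauto.
  apply: psi_at_eq.
  - by case: rS' r'S => -> [] ->; rewrite ?ab //; lia.
  - by rewrite -!val_eqE; case: rS' r'S => -> [] -> /=; lia.
  - by rewrite -val_eqE; case: r'S => -> /=; lia.
have Er : r' = r.
  case: Hr => // ->; move: rnS; rewrite inE /= negb_or => /andP[ra rb].
  by rewrite tpermD // eq_sym.
rewrite {r' Hr}Er -He //; apply: psi_at_eq => //.
- case: Hc => -> //; move: rnS; rewrite !inE negb_or -!val_eqE /= => /andP[ra rb].
  by case: tpermP => // ->; lia.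
- case: Hc => -> //; move: rnS; rewrite !inE negb_or -!val_eqE /= => /andP[ra rb].
  by case: tpermP => // ->; lia.
Qed.

Lemma big_pred2 (R : Type) (idx : R) (op : Monoid.com_law idx) (I : finType)
    (i j : I) (P : pred I) (f : I -> R) :
  i != j -> P =1 pred2 i j -> \big[op/idx]_(k | P k) f k = op (f i) (f j).
Proof.
move=> ij HP; rewrite (bigD1 i) /=; last by rewrite HP /= eqxx.
rewrite (big_pred1 j) // => k; rewrite HP /=.
by case: (k =P i) => [->|_] /=; rewrite ?andbT ?andbF ?(negPf ij).
Qed.

(** Each [s] is grouped with its precomposition by the transposition, and the member with
    [s i1 < s i2] represents the pair. Nothing is divided by 2, so the characteristic is
    arbitrary. *)
Lemma sum_perm_pair (R : nmodType) (m : nat) (i1 i2 : 'I_m) (f g : 'S_m -> R) :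
  i1 != i2 ->
  (forall s, f s + f (tperm i1 i2 * s)%g = g s + g (tperm i1 i2 * s)%g) ->
  \sum_s f s = \sum_s g s.
Proof.
move=> i12 fg.
have pair k : \sum_s k s = \sum_(s : 'S_m | (s i1 < s i2)%N) (k s + k (tperm i1 i2 * s)%g) :> R.
  rewrite (bigID (fun s : 'S_m => (s i1 < s i2)%N)) /= big_split /=; congr (_ + _).
  rewrite (reindex_inj (mulgI (tperm i1 i2))) /=; apply: eq_bigl => s.
  rewrite !permM tpermL tpermR -leqNgt leq_eqVlt.
  by rewrite (inj_eq val_inj) (inj_eq perm_inj) (negPf i12).
by rewrite !pair; apply: eq_bigr => s _; exact: fg.
Qed.

Definition interaction (F : fieldType) (m : nat) (h : F) (x : 'I_m -> F) : F :=
  \prod_(p : 'I_m * 'I_m | (p.1 < p.2)%N)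
    ((1 - h * (x p.2 / x p.1)) / (1 - x p.2 / x p.1)).

(** [u] and [v] give the elements of [{1, ..., n}] to which the variables [x] of
    a level and [w] of the next one are attached. *)
Definition level_kernel (F : fieldType) (n m1 m2 : nat) (h : F)
    (u : 'I_m1 -> 'I_n) (v : 'I_m2 -> 'I_n) (e : 'I_n -> int)
    (x : 'I_m1 -> F) (w : 'I_m2 -> F) : F :=
  (\prod_(p : 'I_m1 * 'I_m2) psi_at h (u p.1) (v p.2) (e (u p.1)) (w p.2 / x p.1))
    * interaction h x.

(** Collects the factors that compare numbers not both in {a, b}. Exchanging a and b in rows or in
    columns leaves this product fixed, so only the omitted factors need computation. *)
Definition outer_kernel (F : fieldType) (n m1 m2 : nat) (h : F) (a b : 'I_n)
    (u : 'I_m1 -> 'I_n) (v : 'I_m2 -> 'I_n) (e : 'I_n -> int)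
    (x : 'I_m1 -> F) (w : 'I_m2 -> F) : F :=
  \prod_(p : 'I_m1 * 'I_m2 | ~~ ((u p.1 \in pred2 a b) && (v p.2 \in pred2 a b)))
    psi_at h (u p.1) (v p.2) (e (u p.1)) (w p.2 / x p.1).

Lemma pred2_tperm (T : finType) (a b x : T) : (tperm a b x \in pred2 a b) = (x \in pred2 a b).
Proof.
rewrite !inE; case: tpermP => [->|->|/eqP/negPf-> /eqP/negPf-> //]; by rewrite !eqxx ?orbT.
Qed.

Section Outer.
Variables (F : fieldType) (n m1 m2 : nat) (h : F) (a b : 'I_n).
Variables (u : 'I_m1 -> 'I_n) (v : 'I_m2 -> 'I_n) (e : 'I_n -> int).
Hypothesis ab : b = a.+1 :> nat.
Implicit Types (x : 'I_m1 -> F) (w : 'I_m2 -> F).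

Lemma outer_kernel_cols (q : 'S_m2) x w :
  (forall c, v (q c) = tperm a b (v c)) ->
  outer_kernel h a b u v e x (w \o q) = outer_kernel h a b u v e x w.
Proof.
move=> vq; rewrite [RHS]/outer_kernel.
rewrite (reindex_inj (h := fun p => (p.1, q p.2))) /=; last first.
  by move=> [r c] [r' c'] /= [-> /perm_inj ->].
apply: eq_big => [[r c]|[r c] /= H]; first by rewrite /= vq pred2_tperm.
rewrite vq; symmetry; apply: (psi_at_swap _ _ ab H) => //; tauto.
Qed.

Lemma outer_kernel_rows (q : 'S_m1) x w :
  (forall c, u (q c) = tperm a b (u c)) ->
  outer_kernel h a b u v e (x \o q) w = outer_kernel h a b u v e x w.
Proof.
move=> uq; rewrite [RHS]/outer_kernel.
rewrite (reindex_inj (h := fun p => (q p.1, p.2))) /=; last first.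
  by move=> [r c] [r' c'] /= [/perm_inj -> ->].
apply: eq_big => [[r c]|[r c] /= H]; first by rewrite /= uq pred2_tperm.
rewrite uq; symmetry; apply: (psi_at_swap _ _ ab H); try tauto.
by rewrite inE negb_or /= => /andP[ra rb]; rewrite tpermD // eq_sym.
Qed.

(** Covers two uses: row labels exchanged at a level without b, and row labels kept while the
    exponents at a and b change. *)
Lemma outer_kernel_relabel (u' : 'I_m1 -> 'I_n) (e' : 'I_n -> int) x w :
  (forall r, u' r = u r) \/ (forall r, u' r = tperm a b (u r)) ->
  (forall r, r \notin pred2 a b -> e' r = e r) ->
  outer_kernel h a b u' v e' x w = outer_kernel h a b u v e x w.
Proof.
move=> Hu He; have Hu' r : u' r = u r \/ u' r = tperm a b (u r).
  by case: Hu => ->; tauto.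
have mu r : (u' r \in pred2 a b) = (u r \in pred2 a b).
  by case: (Hu' r) => ->; rewrite ?pred2_tperm.
apply: eq_big => [[r c]|[r c] /=]; rewrite /= mu // => H.
apply: (psi_at_swap _ _ ab H) => //; first tauto.
move=> rn; rewrite He ?mu //; case: (Hu' r) => -> //.
by move: rn; rewrite inE negb_or /= => /andP[ra rb]; rewrite tpermD // eq_sym.
Qed.

Lemma level_kernel_outer x w :
  level_kernel h u v e x w =
  (\prod_(r | u r \in pred2 a b) \prod_(c | v c \in pred2 a b)
     psi_at h (u r) (v c) (e (u r)) (w c / x r))
  * outer_kernel h a b u v e x w * interaction h x.
Proof.
rewrite /level_kernel.
rewrite (bigID (fun p => (u p.1 \in pred2 a b) && (v p.2 \in pred2 a b))) /=.
by rewrite pair_big.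
Qed.
End Outer.

Definition outer_interaction (F : fieldType) (m : nat) (h : F) (i1 i2 : 'I_m) (x : 'I_m -> F) : F :=
  \prod_(p : 'I_m * 'I_m | (p.1 < p.2)%N && (p != (i1, i2)))
    ((1 - h * (x p.2 / x p.1)) / (1 - x p.2 / x p.1)).

Lemma interactionE (F : fieldType) (m : nat) (h : F) (i1 i2 : 'I_m) (x : 'I_m -> F) :
  (i1 < i2)%N ->
  interaction h x = (1 - h * (x i2 / x i1)) / (1 - x i2 / x i1) * outer_interaction h i1 i2 x.
Proof. by move=> i12; rewrite /interaction (bigD1 (i1, i2)). Qed.

(** Consecutive positions compare alike with any third one, so the transposition permutes the
    increasing pairs other than [(i1, i2)]. *)
Lemma outer_interaction_tperm (F : fieldType) (m : nat) (h : F) (i1 i2 : 'I_m) (x : 'I_m -> F) :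
  i2 = i1.+1 :> nat ->
  outer_interaction h i1 i2 (x \o tperm i1 i2) = outer_interaction h i1 i2 x.
Proof.
move=> i12; rewrite [RHS]/outer_interaction.
rewrite (reindex_inj (h := fun p => (tperm i1 i2 p.1, tperm i1 i2 p.2))) /=; last first.
  by move=> [r c] [r' c'] /= [/perm_inj -> /perm_inj ->].
apply: eq_bigl => -[r c] /=; rewrite !xpair_eqE -!val_eqE /=.
case: tpermP => [->|->|/eqP + /eqP]; case: tpermP => [->|->|/eqP + /eqP];
  rewrite -?val_eqE /=; lia.
Qed.

(** * Rational identities *)

(** At [r] = z_a/z_{a+1}, [coef_swap] and [coef_id] are the coefficients of W(s(z)) and W(z) in the
    relation for k < l. *)
Definition coef_swap (F : fieldType) (h r : F) : F := (1 - h * r) / (1 - r).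
Definition coef_id (F : fieldType) (h : F) (m : int) (r : F) : F :=
  (h - 1) * (r ^ (m + 1) / (1 - r)).

Lemma single_row_identity (F : fieldType) (h x v w : F) (m : int) :
  x != 0 -> v != 0 -> w != 0 -> v != w ->
  (1 - h * (v / x)) * (w / x) ^ (- m) =
  coef_swap h (v / w) * ((w / x) ^ (- m) * (1 - v / x))
  + coef_id h m (v / w) * ((v / x) ^ (- m) * (1 - w / x)).
Proof.
move=> x0 v0 w0 vw; rewrite /coef_swap /coef_id expfzDr ?mulf_neq0 ?invr_eq0 //.
rewrite expr1z -!invr_expz !expfzMl -!expfV.
have := expfz_neq0 m v0; have := expfz_neq0 m w0; have := expfz_neq0 m x0.
have wv : w - v != 0 by rewrite subr_eq0 eq_sym.
(* The m-th powers become independent nonzero elements, so [field] applies with [m] unspecified. *)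
move: (v ^ m) (w ^ m) (x ^ m) => V W X X0 W0 V0.
by field; rewrite ?X0 ?W0 ?V0 ?x0 ?v0 ?w0 ?wv.
Qed.

(** The product of the four factors [psi_at] whose row and column both lie in
    [{a, b}], for rows [x, y] and columns [v, w]. *)
Definition cross (F : fieldType) (h : F) (k l : int) (x y v w : F) : F :=
  (v / x) ^ (- k) * (1 - w / x) * ((1 - h * (v / y)) * (w / y) ^ (- l)).

(** Compares the coefficients of a single lower sum in [cross_exchange]. In the application [m],
    [ma], [mb] are m_{k,l}, m_{k,j}, m_{l,j}. *)
Lemma cross_identity (F : fieldType) (h x y v w : F) (m ma mb : int) (eps : bool) :
  x != 0 -> y != 0 -> v != 0 -> w != 0 -> x != y -> v != w ->
  ma = m + mb + eps%:Z ->
  coef_id h m (x / y) * cross h mb ma x y v w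
  + coef_swap h (x / y) * cross h mb ma y x v w =
  coef_swap h (v / w) * cross h ma mb x y w v
  + coef_id h m (v / w) * cross h ma mb x y v w.
Proof.
move=> x0 y0 v0 w0 xy vw ->; rewrite /coef_swap /coef_id /cross.
rewrite -!invr_expz !expfzDr ?mulf_neq0 ?invr_eq0 // !expr1z !expfzMl -!expfV.
have := expfz_neq0 m v0; have := expfz_neq0 m w0.
have := expfz_neq0 m x0; have := expfz_neq0 m y0.
have := expfz_neq0 mb v0; have := expfz_neq0 mb w0.
have := expfz_neq0 mb x0; have := expfz_neq0 mb y0.
have wv : w - v != 0 by rewrite subr_eq0 eq_sym.
have yx : y - x != 0 by rewrite subr_eq0 eq_sym.
move: (v ^ m) (w ^ m) (x ^ m) (y ^ m) (v ^ mb) (w ^ mb) (x ^ mb) (y ^ mb).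
move=> V W X Y V' W' X' Y' Y'0 X'0 W'0 V'0 Y0 X0 W0 V0.
(* Only the powers with exponent [eps] remain; the values 0 and 1 give two separate rational
   identities. *)
case: eps => /=; rewrite ?expr0z ?expr1z;
  by field; rewrite ?oner_neq0 ?X0 ?W0 ?V0 ?Y0 ?X'0 ?W'0 ?V'0 ?Y'0 ?x0 ?y0 ?v0 ?w0 ?wv ?yx.
Qed.

(** Here [g] and [g'] stand for the lower sum at a point and at the point with two variables
    exchanged. Their coefficients agree by [cross_identity] at (x, y) and at (y, x). *)
Lemma cross_exchange (F : fieldType) (h x y v w g g' : F) (m ma mb : int) (eps : bool) :
  x != 0 -> y != 0 -> v != 0 -> w != 0 -> x != y -> v != w ->
  ma = m + mb + eps%:Z ->
  (coef_swap h (x / y) * g' + coef_id h m (x / y) * g)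
    * (cross h mb ma x y v w * coef_swap h (y / x))
  + (coef_swap h (y / x) * g + coef_id h m (y / x) * g')
    * (cross h mb ma y x v w * coef_swap h (x / y)) =
  coef_swap h (v / w) * (g * (cross h ma mb x y w v * coef_swap h (y / x))
                         + g' * (cross h ma mb y x w v * coef_swap h (x / y)))
  + coef_id h m (v / w) * (g * (cross h ma mb x y v w * coef_swap h (y / x))
                           + g' * (cross h ma mb y x v w * coef_swap h (x / y))).
Proof.
move=> x0 y0 v0 w0 xy vw Ema; have yx : y != x by rewrite eq_sym.
have Kxy := cross_identity h x0 y0 v0 w0 xy vw Ema.
have Kyx := cross_identity h y0 x0 v0 w0 yx vw Ema.
transitivity (g * coef_swap h (y / x) *
  (coef_id h m (x / y) * cross h mb ma x y v w
   + coef_swap h (x / y) * cross h mb ma y x v w) +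
  g' * coef_swap h (x / y) *
  (coef_id h m (y / x) * cross h mb ma y x v w
   + coef_swap h (y / x) * cross h mb ma x y v w)); first by ring.
by rewrite Kxy Kyx; ring.
Qed.

(** For a and b in the same part the two exponents agree. In general only the sum over both orders
    of the rows, not each term, is symmetric in the columns. *)
Lemma cross_sym (F : fieldType) (h x y v w : F) (m : int) :
  x != 0 -> y != 0 -> v != 0 -> w != 0 -> x != y ->
  cross h m m x y v w * coef_swap h (y / x)
  + cross h m m y x v w * coef_swap h (x / y) =
  cross h m m x y w v * coef_swap h (y / x)
  + cross h m m y x w v * coef_swap h (x / y).
Proof.
move=> x0 y0 v0 w0 xy; rewrite /coef_swap /cross.
rewrite -!invr_expz !expfzMl -!expfV.
have := expfz_neq0 m v0; have := expfz_neq0 m w0.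
have := expfz_neq0 m x0; have := expfz_neq0 m y0.
have xy' : x - y != 0 by rewrite subr_eq0.
have yx : y - x != 0 by rewrite subr_eq0 eq_sym.
move: (v ^ m) (w ^ m) (x ^ m) (y ^ m) => V W X Y Y0 X0 W0 V0.
by field; rewrite ?X0 ?W0 ?V0 ?Y0 ?x0 ?y0 ?v0 ?w0 ?xy' ?yx.
Qed.

(** * Exchange of two variables at one level *)

Section Steps.
Variables (F : fieldType) (n m1 m2 : nat) (h : F) (a b : 'I_n).
Variables (u : 'I_m1 -> 'I_n) (v : 'I_m2 -> 'I_n) (e e' : 'I_n -> int).
Hypothesis ab : b = a.+1 :> nat.
Hypothesis u_mono : {mono u : i j / (i < j)%N}.
Hypothesis v_mono : {mono v : i j / (i < j)%N}.
Hypothesis e'E : forall r, e' r = e (tperm a b r).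
Implicit Types (x X : 'I_m1 -> F) (w : 'I_m2 -> F).

Lemma mono_ord_inj m (f : 'I_m -> 'I_n) : {mono f : i j / (i < j)%N} -> injective f.
Proof.
move=> fm i j fij; apply: val_inj; case: (ltngtP i j) => // lt_ij.
  by have := fm i j; rewrite fij lt_ij ltnn.
by have := fm j i; rewrite fij lt_ij ltnn.
Qed.

Lemma ord_neqS : a != b.
Proof. by rewrite -val_eqE /= ab neq_ltn leqnn. Qed.

Lemma mem_pred2_at m (f : 'I_m -> 'I_n) (i j : 'I_m) :
  injective f -> f i = a -> f j = b -> (fun k => f k \in pred2 a b) =1 pred2 i j.
Proof. by move=> fI <- <- k; rewrite !inE !(inj_eq fI). Qed.

Lemma e'_outside r : r \notin pred2 a b -> e' r = e r.
Proof. by rewrite inE negb_or /= e'E => /andP[ra rb]; rewrite tpermD // eq_sym. Qed.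

Lemma level_kernel_cols_sym (q : 'S_m2) x w :
  (forall r, u r \notin pred2 a b) -> (forall c, v (q c) = tperm a b (v c)) ->
  level_kernel h u v e x (w \o q) = level_kernel h u v e x w.
Proof.
move=> un vq; rewrite !(level_kernel_outer _ a b) (outer_kernel_cols h u e ab _ _ vq).
by congr (_ * _ * _); rewrite !big_pred0 // => r; rewrite (negPf (un r)).
Qed.

(** Exactly one row has its label in {a, b}. Outside [outer_kernel] there remain this row and two
    columns, which is [single_row_identity]. *)
Lemma level_kernel_exchange (i : 'I_m1) (q1 q2 : 'I_m2) (m : int) x w :
  u i = a -> (forall r, u r != b) -> v q1 = a -> v q2 = b -> e a = - m ->
  (forall r, x r != 0) -> (forall c, w c != 0) -> w q1 != w q2 ->
  level_kernel h (tperm a b \o u) v e' x w =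
  coef_swap h (w q1 / w q2) * level_kernel h u v e x (w \o tperm q1 q2)
  + coef_id h m (w q1 / w q2) * level_kernel h u v e x w.
Proof.
move=> ui ub vq1 vq2 ea x0 w0 w12.
have u_inj := mono_ord_inj u_mono; have v_inj := mono_ord_inj v_mono.
have vq c : v (tperm q1 q2 c) = tperm a b (v c) by rewrite (inj_tperm _ _ _ v_inj) vq1 vq2.
have q12 : q1 != q2 by rewrite -(inj_eq v_inj) vq1 vq2 ord_neqS.
have rowE : (fun r => u r \in pred2 a b) =1 pred1 i.
  by move=> r; rewrite !inE (negPf (ub r)) orbF -ui (inj_eq u_inj).
have rowE' : (fun r => tperm a b (u r) \in pred2 a b) =1 pred1 i.
  by move=> r; rewrite /= pred2_tperm; exact: rowE.
have colE := mem_pred2_at v_inj vq1 vq2.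
rewrite !(level_kernel_outer _ a b) (outer_kernel_cols h u e ab _ _ vq).
rewrite (outer_kernel_relabel h v ab _ _ (or_intror (fun=> erefl)) e'_outside).
rewrite (big_pred1 i) // !(big_pred1 i rowE) !(big_pred2 _ _ q12 colE) /=.
rewrite tpermL tpermR ui vq1 vq2 tpermL e'E tpermR ea /psi_at !ltnn !eqxx.
have bla : (b < a)%N = false by rewrite ab ltnNge leqnSn.
have alb : (a < b)%N by rewrite ab.
rewrite bla alb (eq_sym b) (negPf ord_neqS).
by rewrite (single_row_identity _ _ (x0 i) (w0 q1) (w0 q2) w12); ring.
Qed.

(** * Levels with both numbers among the rows *)

Section BothRows.
Variables (i1 i2 : 'I_m1) (q1 q2 : 'I_m2).
Hypotheses (ui1 : u i1 = a) (ui2 : u i2 = b) (vq1 : v q1 = a) (vq2 : v q2 = b).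

Definition outer x w := outer_kernel h a b u v e x w * outer_interaction h i1 i2 x.

(** A position strictly between [i1] and [i2] would carry a number strictly between a and a + 1. *)
Lemma positionS : i2 = i1.+1 :> nat.
Proof.
have lt12 : (i1 < i2)%N by rewrite -u_mono ui1 ui2 ab.
apply/eqP; rewrite eqn_leq lt12 andbT leqNgt; apply/negP => lt1.
have lt3 : (i1.+1 < m1)%N by apply: ltn_trans lt1 _.
have := u_mono i1 (Ordinal lt3); have := u_mono (Ordinal lt3) i2.
rewrite ui1 ui2 ab /= lt1 ltnSn; lia.
Qed.

Lemma positions_neq : i1 != i2.
Proof. by rewrite -val_eqE /= positionS neq_ltn leqnn. Qed.

Lemma columns_neq : q1 != q2.
Proof. by apply: contraNneq ord_neqS => qq; rewrite -vq1 -vq2 qq. Qed.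

Lemma level_kernel_cross (f : 'I_n -> int) (ka kb : int) x w :
  (forall r, r \notin pred2 a b -> f r = e r) -> f a = - ka -> f b = - kb ->
  level_kernel h u v f x w =
  cross h ka kb (x i1) (x i2) (w q1) (w q2) * coef_swap h (x i2 / x i1) * outer x w.
Proof.
move=> fe fa fb; have u_inj := mono_ord_inj u_mono; have v_inj := mono_ord_inj v_mono.
have bla : (b < a)%N = false by rewrite ab ltnNge leqnSn.
have alb : (a < b)%N by rewrite ab.
rewrite (level_kernel_outer _ a b) (@interactionE _ _ _ i1 i2); last first.
  by rewrite positionS.
rewrite (outer_kernel_relabel h v ab _ _ (or_introl (fun=> erefl)) fe).
rewrite (big_pred2 _ _ positions_neq (mem_pred2_at u_inj ui1 ui2)) /=.
rewrite !(big_pred2 _ _ columns_neq (mem_pred2_at v_inj vq1 vq2)) /=.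
rewrite ui1 ui2 vq1 vq2 fa fb /psi_at !ltnn !eqxx bla alb (eq_sym b) (negPf ord_neqS).
by rewrite /cross /coef_swap /outer; ring.
Qed.

Lemma outer_tperm x w :
  (outer (x \o tperm i1 i2) w = outer x w) * (outer x (w \o tperm q1 q2) = outer x w).
Proof.
have uq r : u (tperm i1 i2 r) = tperm a b (u r).
  by rewrite (inj_tperm _ _ _ (mono_ord_inj u_mono)) ui1 ui2.
have vq c : v (tperm q1 q2 c) = tperm a b (v c).
  by rewrite (inj_tperm _ _ _ (mono_ord_inj v_mono)) vq1 vq2.
rewrite /outer (outer_kernel_rows h v e ab _ _ uq) (outer_kernel_cols h u e ab _ _ vq).
by rewrite (outer_interaction_tperm _ _ positionS).
Qed.

Lemma comp_tperm_perm X (s : 'S_m1) : X \o (tperm i1 i2 * s)%g = (X \o s) \o tperm i1 i2.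
Proof. by apply: funext => r /=; rewrite permM. Qed.

Lemma comp_tpermK x : (x \o tperm i1 i2) \o tperm i1 i2 = x.
Proof. by apply: funext => r /=; rewrite tpermK. Qed.

(** In each pair of permutations [outer] is a common factor, and what remains is [cross_exchange].
    The exponents at a and b trade places in [e'], hence [cross h mb ma] on the left. *)
Lemma sum_level_kernel_exchange (m ma mb : int) (eps : bool) X w (G G' : ('I_m1 -> F) -> F) :
  e a = - ma -> e b = - mb -> ma = m + mb + eps%:Z ->
  (forall r, X r != 0) -> injective X -> (forall c, w c != 0) -> w q1 != w q2 ->
  (forall x, (forall r, x r != 0) -> x i1 != x i2 ->
     G' x = coef_swap h (x i1 / x i2) * G (x \o tperm i1 i2)
            + coef_id h m (x i1 / x i2) * G x) ->
  \sum_(s : 'S_m1) G' (X \o s) * level_kernel h u v e' (X \o s) w =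
  coef_swap h (w q1 / w q2)
    * (\sum_(s : 'S_m1) G (X \o s) * level_kernel h u v e (X \o s) (w \o tperm q1 q2))
  + coef_id h m (w q1 / w q2)
    * (\sum_(s : 'S_m1) G (X \o s) * level_kernel h u v e (X \o s) w).
Proof.
move=> ea eb mE X0 X_inj w0 w12 GG'.
rewrite !mulr_sumr -big_split /=; apply: (sum_perm_pair positions_neq) => s.
rewrite comp_tperm_perm; set x := X \o s.
have x0 r : x r != 0 by rewrite X0.
have x12 : x i1 != x i2 by rewrite (inj_eq X_inj) (inj_eq perm_inj) positions_neq.
have e'a : e' a = - mb by rewrite e'E tpermL.
have e'b : e' b = - ma by rewrite e'E tpermR.
rewrite !(level_kernel_cross _ _ e'_outside e'a e'b).
rewrite !(level_kernel_cross _ _ (fun=> fun=> erefl) ea eb).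
(* The same relation at the exchanged point: the ratio is inverted and the two values of [G] trade
   places. *)
have GG'2 : G' (x \o tperm i1 i2) = coef_swap h (x i2 / x i1) * G x
    + coef_id h m (x i2 / x i1) * G (x \o tperm i1 i2).
  rewrite GG' ?comp_tpermK /= ?tpermL ?tpermR //.
  by rewrite eq_sym.
rewrite GG'2 GG' // !outer_tperm /= !tpermL !tpermR.
have := cross_exchange h (G x) (G (x \o tperm i1 i2)) (x0 i1) (x0 i2)
  (w0 q1) (w0 q2) x12 w12 mE.
move: (G x) (G _) (outer x w) (cross h ma mb) (cross h mb ma) (coef_swap h) (coef_id h m).
move=> g g' o B B' c1 c2 id; transitivity (o * (
  (c1 (x i1 / x i2) * g' + c2 (x i1 / x i2) * g)
    * (B' (x i1) (x i2) (w q1) (w q2) * c1 (x i2 / x i1))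
  + (c1 (x i2 / x i1) * g + c2 (x i2 / x i1) * g')
    * (B' (x i2) (x i1) (w q1) (w q2) * c1 (x i1 / x i2)))); first by ring.
by rewrite id; ring.
Qed.

Lemma sum_level_kernel_sym (m : int) X w (G : ('I_m1 -> F) -> F) :
  e a = - m -> e b = - m ->
  (forall r, X r != 0) -> injective X -> (forall c, w c != 0) ->
  (forall x, (forall r, x r != 0) -> G (x \o tperm i1 i2) = G x) ->
  \sum_(s : 'S_m1) G (X \o s) * level_kernel h u v e (X \o s) (w \o tperm q1 q2) =
  \sum_(s : 'S_m1) G (X \o s) * level_kernel h u v e (X \o s) w.
Proof.
move=> ea eb X0 X_inj w0 GG; apply: (sum_perm_pair positions_neq) => s.
rewrite comp_tperm_perm; set x := X \o s.
have x0 r : x r != 0 by rewrite X0.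
have x12 : x i1 != x i2 by rewrite (inj_eq X_inj) (inj_eq perm_inj) positions_neq.
rewrite !(level_kernel_cross _ _ (fun=> fun=> erefl) ea eb).
rewrite !GG // !outer_tperm /= !tpermL !tpermR.
have := cross_sym h m (x0 i1) (x0 i2) (w0 q1) (w0 q2) x12.
move: (G x) (outer x w) (cross h m m) (coef_swap h) => g o B c id.
transitivity (g * o * (B (x i1) (x i2) (w q2) (w q1) * c (x i2 / x i1) +
     B (x i2) (x i1) (w q2) (w q1) * c (x i1 / x i2))); first by ring.
by rewrite -id; ring.
Qed.
End BothRows.
End Steps.

(** * Induction on the levels *)

(** The sum G_j of the overview: [w] replaces the variables of level j, and the lowest levels are
    summed innermost. The maps [u j] give the numbers attached to the variables of level j. *)
Fixpoint level_weight (F : fieldType) (n : nat) (m : nat -> nat) (h : F)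
    (u : forall j, 'I_(m j) -> 'I_n) (e : nat -> 'I_n -> int)
    (T : forall j, 'I_(m j) -> F) (j : nat) : ('I_(m j) -> F) -> F :=
  match j with
  | 0 => fun=> 1
  | j'.+1 => fun w => \sum_(s : 'S_(m j'))
      level_weight h u e T (T j' \o s)
      * level_kernel h (u j') (u j'.+1) (e j') (T j' \o s) w
  end.

Arguments level_weight [F n m] h u e T j _.

Section Levels.
Variables (F : fieldType) (n N : nat) (m : nat -> nat) (h : F).
Variables (u u' : forall j, 'I_(m j) -> 'I_n) (e e' : nat -> 'I_n -> int).
Variables (T : forall j, 'I_(m j) -> F) (a b : 'I_n) (k l : nat).
Arguments u : clear implicits.
Arguments u' : clear implicits.
Arguments T : clear implicits.
Hypothesis ab : b = a.+1 :> nat.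
Hypothesis u_mono : forall j, (j <= N)%N -> {mono u j : r s / (r < s)%N}.
Hypothesis u_a : forall j, (j <= N)%N -> (a \in codom (u j)) = (k < j)%N.
Hypothesis u_b : forall j, (j <= N)%N -> (b \in codom (u j)) = (l < j)%N.
Hypothesis T0 : forall j r, (j < N)%N -> T j r != 0.
Hypothesis T_inj : forall j, (j < N)%N -> injective (T j).

Lemma level_weight_sym j (q1 q2 : 'I_(m j)) w :
  k = l -> (forall j, (k < j)%N -> (j < N)%N -> e j a = e j b) ->
  (j <= N)%N -> u j q1 = a -> u j q2 = b -> (forall c, w c != 0) ->
  level_weight h u e T j (w \o tperm q1 q2) = level_weight h u e T j w.
Proof.
move=> kl eab; elim: j q1 q2 w => [//|j IH] q1 q2 w jN uq1 uq2 w0 /=.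
have jN' : (j <= N)%N := ltnW jN.
(* For j <= k no row carries a or b, so each kernel is already symmetric in the two columns. For j >
   k both are rows, and the symmetry of the lower sum is used. *)
have [jk|kj] := leqP j k.
  apply: eq_bigr => s _; congr (_ * _).
  apply: (level_kernel_cols_sym h (e j) ab) => [r|c]; last first.
    by rewrite (inj_tperm _ _ _ (mono_ord_inj (u_mono jN))) uq1 uq2.
  have := u_a jN'; have := u_b jN'; rewrite -kl ltnNge jk /= => nb na.
  rewrite !inE; apply/norP; split; apply/eqP => E.
    by move: na; rewrite -E codom_f.
  by move: nb; rewrite -E codom_f.
have /codomP[i1 /esym ui1] : a \in codom (u j) by rewrite u_a.
have /codomP[i2 /esym ui2] : b \in codom (u j) by rewrite u_b // -kl.
apply: (sum_level_kernel_sym h (m := - e j a) ab (u_mono jN') (u_mono jN) ui1 ui2 uq1 uq2).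
- by rewrite opprK.
- by rewrite opprK -eab.
- by move=> r; exact: T0.
- exact: T_inj.
- by [].
- by move=> x x0; exact: IH.
Qed.

Section Exchange.
Variable m0 : int.
Hypothesis kl : (k < l)%N.
Hypothesis u'_low : forall j, (j <= l)%N -> (j <= N)%N -> u' j = tperm a b \o u j.
Hypothesis u'_high : forall j, (l < j)%N -> (j <= N)%N -> u' j = u j.
Hypothesis e'E : forall j r, e' j r = e j (tperm a b r).
Hypothesis e_l : e l a = - m0.
Hypothesis e_high : forall j, (l < j)%N -> (j < N)%N ->
  exists eps : bool, - e j a = m0 - e j b + eps%:Z.

(** None of these levels contains b, so replacing a by a + 1 preserves every comparison; the
    exponents follow the labels. *)
Lemma level_weight_low j w : (j <= l)%N -> (j <= N)%N ->
  level_weight h u' e' T j w = level_weight h u e T j w :> F.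
Proof.
elim: j w => [//|j IH] w jl jN /=; apply: eq_bigr => s _.
rewrite IH; [|exact: ltnW|exact: ltnW]; congr (_ * (_ * _)).
apply: eq_bigr => -[r c] _ /=.
rewrite !u'_low //= ?e'E ?tpermK; try exact: ltnW.
have nb i (iN : (i <= N)%N) : (i <= l)%N -> forall r, u i r != b.
  move=> il r'; apply/eqP => E; have := u_b iN.
  by rewrite -E codom_f ltnNge il.
have rb := nb j (ltnW jN) (ltnW jl) r; have cb := nb j.+1 jN jl c.
rewrite -val_eqE /= in rb; rewrite -val_eqE /= in cb.
apply: psi_at_eq => //; last by rewrite (inj_eq perm_inj).
case: (tpermP a b (u j.+1 c)) => [ca|cE|/eqP ca _]; rewrite ?ca ?tpermL.
- case: tpermP => [->|rE|/eqP ra _]; rewrite ?ab.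
  + by rewrite !ltnn.
  + by rewrite rE eqxx in rb.
  + rewrite -val_eqE /= in ra; lia.
- by rewrite cE eqxx in cb.
- rewrite -val_eqE /= in ca; case: tpermP => [->|rE|/eqP ra _] //; first by lia.
  by rewrite rE eqxx in rb.
Qed.

Lemma level_weight_exchange j (q1 q2 : 'I_(m j)) w :
  (l < j)%N -> (j <= N)%N -> u j q1 = a -> u j q2 = b ->
  (forall c, w c != 0) -> w q1 != w q2 ->
  level_weight h u' e' T j w =
  coef_swap h (w q1 / w q2) * level_weight h u e T j (w \o tperm q1 q2)
  + coef_id h m0 (w q1 / w q2) * level_weight h u e T j w.
Proof.
elim: j q1 q2 w => [//|j IH] q1 q2 w lj jN uq1 uq2 w0 w12 /=.
have jN' : (j <= N)%N := ltnW jN.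
(* If j = l, then b enters as a column at level j + 1 while the rows contain only a: the relation
   starts here. If j > l, both are rows and the induction hypothesis carries it upwards. *)
have [jl|lj'] := leqP j l.
  have {lj jl}jl : j = l by apply/eqP; rewrite eqn_leq jl -ltnS.
  subst j.
  have /codomP[i /esym ui] : a \in codom (u l) by rewrite u_a.
  rewrite !mulr_sumr -big_split /=; apply: eq_bigr => s _.
  rewrite level_weight_low // u'_low // u'_high //.
  have ub r : u l r != b.
    by apply/eqP => E; have := u_b jN'; rewrite -E codom_f ltnn.
  have x0 r : (T l \o s) r != 0 by exact: T0.
  rewrite (level_kernel_exchange h ab (u_mono jN') (u_mono jN) (e'E l)
             ui ub uq1 uq2 e_l x0 w0 w12).
  by ring.
have [eps eE] := e_high lj' jN.
have /codomP[i1 /esym ui1] : a \in codom (u j) by rewrite u_a // (ltn_trans kl).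
have /codomP[i2 /esym ui2] : b \in codom (u j) by rewrite u_b.
rewrite !u'_high //.
apply: (sum_level_kernel_exchange (ma := - e j a) (mb := - e j b) ab (u_mono jN')
  (u_mono jN) (e'E j) ui1 ui2 uq1 uq2 _ _ eE) => //; rewrite ?opprK //.
- by move=> r; exact: T0.
- exact: T_inj.
- by move=> x x0 x12; exact: IH.
Qed.
End Exchange.
End Levels.

(** * Weight functions as iterated sums *)

Lemma level_weight_ext (F : fieldType) (n : nat) (m : nat -> nat) (h : F)
    (u : forall j, 'I_(m j) -> 'I_n) (e : nat -> 'I_n -> int)
    (T T' : forall j, 'I_(m j) -> F) (j : nat) (w : 'I_(m j) -> F) :
  (forall i, (i < j)%N -> T i = T' i) ->
  level_weight h u e T j w = level_weight h u e T' j w.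
Proof.
elim: j w => [//|j IH] w TT' /=; apply: eq_bigr => s _.
by rewrite TT' // IH // => i ij; apply: TT'; exact: ltnW.
Qed.

Lemma Sym_tvarC (F : fieldType) (N : nat) (lam : 'I_N -> nat) (j k : 'I_N)
    (f : tvars F lam -> F) :
  j != k -> Sym_tvar j (Sym_tvar k f) = Sym_tvar k (Sym_tvar j f).
Proof.
move=> jk; apply: funext => t; rewrite /Sym_tvar exchange_big /=.
apply: eq_bigr => s _; apply: eq_bigr => s' _; congr f.
have kj : k != j by rewrite eq_sym.
apply: functional_extensionality_dep => i.
case: (eqVneq k i) => [<-|ki].
  by rewrite dfwithin (dfwithout _ _ jk) dfwithout // dfwithin.
case: (eqVneq j i) => [<-|ji]; last by rewrite !dfwithout.
by rewrite dfwithin dfwithout // dfwithin dfwithout.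
Qed.

(** In [Sym_tvars] level 1 is outermost, whereas [level_weight] sums it innermost; this moves a
    symmetrization inside. *)
Lemma Sym_tvar_foldr (F : fieldType) (N : nat) (lam : 'I_N -> nat) (j : 'I_N)
    (r : seq 'I_N) (f : tvars F lam -> F) : j \notin r ->
  Sym_tvar j (foldr (@Sym_tvar F N lam) f r) = foldr (@Sym_tvar F N lam) (Sym_tvar j f) r.
Proof.
elim: r => //= i r IH; rewrite inE negb_or => /andP[ji jr].
by rewrite Sym_tvarC // IH.
Qed.

Lemma level_kernel_no_rows (F : fieldType) (n m1 m2 : nat) (h : F)
    (u : 'I_m1 -> 'I_n) (v : 'I_m2 -> 'I_n) (e : 'I_n -> int) x w :
  ('I_m1 -> False) -> level_kernel h u v e x w = 1.
Proof.
move=> no_ord; rewrite /level_kernel /interaction.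
by rewrite !big1 ?mulr1 // => -[i ?]; case: (no_ord i).
Qed.

Lemma filter_enum_ord_gt0 (N : nat) :
  (0 < N)%N -> [seq k : 'I_N <- enum 'I_N | (0 < k)%N] = drop 1 (enum 'I_N).
Proof.
case: N => // N _; rewrite enum_ordSl /= drop0.
by apply/all_filterP/allP => k /mapP[i _ ->].
Qed.

(** * From iterated symmetrization to the recursive sum *)

Section Weight.
Variables (R : realType) (F : fieldType) (n N : nat).
Variables (lam : 'I_N -> nat) (Delta : set 'rV[R]_N) (I : 'I_N -> {set 'I_n.+1}).
Variables (z : 'I_n.+1 -> F) (h : F).
Implicit Type t : tvars F lam.

Definition position (j : nat) (c : 'I_(lamc lam j)) : 'I_n.+1 := ith I j c.

(** The ordinal j, read as a part, stands for I_(j+1), whence the second index of the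
    characteristic. The exponent 0 for a number in no part matches the value 1 in [psi]. *)
Definition psi_exponent (j : nat) (r : 'I_n.+1) : int :=
  if insub j is Some k then
    if [pick i | r \in I i] is Some i then - int_char Delta i k else 0
  else 0.

Definition tlevel (t : tvars F lam) (j : nat) (c : 'I_(lamc lam j)) : F := tz t z j c.
Arguments position : clear implicits.
Arguments tlevel : clear implicits.

Definition level_factor t (j : nat) : F :=
  level_kernel h (position j) (position j.+1) (psi_exponent j) (tlevel t j) (tlevel t j.+1).

Lemma weight_termE t : weight_term Delta I z h t = \prod_(k < N | (0 < k)%N) level_factor t k.
Proof.
apply: eq_bigr => k _; rewrite big_split /= /level_factor /level_kernel /interaction.
rewrite pair_big pair_big_dep /=; congr (_ * _); apply: eq_bigr => -[r c] _.
rewrite /= /psi /psi_at /psi_exponent valK; do 2 case: ifP => // _.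
by case: pickP => //= _; rewrite expr0z.
Qed.

Lemma tlevel_dfwith_neq t (k : 'I_N) y (j : nat) : j != k -> tlevel (dfwith t k y) j = tlevel t j.
Proof.
move=> jk; apply: funext => c; rewrite /tlevel /tz.
by case: insubP => // k' _ k'E; rewrite dfwithout // -val_eqE /= k'E eq_sym.
Qed.

Lemma tlevel_ord t (k : 'I_N) : tlevel t k = t k.
Proof. by apply: funext => c; rewrite /tlevel /tz !valK. Qed.

(** Interpolates between the unsymmetrized term (j = 1) and the full sum (j = N): the levels below j
    are already symmetrized. *)
Definition partial_term (j : nat) t : F :=
  level_weight h position psi_exponent (tlevel t) j (tlevel t j)
  * \prod_(k < N | (j <= k)%N) level_factor t k.

(** The factors of levels above k do not involve the variables of level k, so they leave the sum;
    the factor of level k supplies the next kernel in [level_weight]. *)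
Lemma Sym_partial_term (k : 'I_N) : Sym_tvar k (partial_term k) = partial_term k.+1.
Proof.
apply: funext => t; rewrite /partial_term /= mulr_suml; apply: eq_bigr => s _.
set t' := dfwith _ _ _.
have t'E (j : nat) : j != k -> tlevel t' j = tlevel t j by exact: tlevel_dfwith_neq.
have t'k : tlevel t' k = tlevel t k \o s.
  by rewrite !tlevel_ord /t' dfwithin; exact: funext.
have lt'E (j : nat) : (k < j)%N -> level_factor t' j = level_factor t j.
  move=> kj; rewrite /level_factor !t'E // neq_ltn ?kj ?orbT //.
  by rewrite (ltn_trans kj) ?orbT.
rewrite (bigD1 k) //= mulrA; congr (_ * _); last first.
  apply: eq_big => [i|i /andP[ki ik]]; first by rewrite -val_eqE /= ltn_neqAle eq_sym andbC.
  by rewrite lt'E // ltn_neqAle ki andbT eq_sym.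
rewrite t'k /level_factor t'k t'E ?neq_ltn ?ltnSn ?orbT //.
congr (_ * _); apply: level_weight_ext => i ik.
by apply: t'E; rewrite neq_ltn ik.
Qed.

Lemma Sym_partial_term_drop d j : (d + j = N)%N ->
  foldr (@Sym_tvar F N lam) (partial_term j) (drop j (enum 'I_N)) = partial_term N.
Proof.
elim: d j => [|d IH] j djN.
  by have -> : j = N := djN; rewrite drop_oversize ?size_enum_ord.
have jN : (j < N)%N by rewrite -djN addSn ltnS leq_addl.
have dropE : drop j (enum 'I_N) = Ordinal jN :: drop j.+1 (enum 'I_N).
  rewrite (drop_nth (Ordinal jN)) ?size_enum_ord //; congr (_ :: _).
  exact: (nth_ord_enum _ (Ordinal jN)).
have := drop_uniq j (enum_uniq 'I_N); rewrite dropE /= => /andP[jnotin _].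
rewrite Sym_tvar_foldr // (Sym_partial_term (Ordinal jN)) IH //.
by rewrite addnS.
Qed.

Lemma lamc0 : lamc lam 0 = 0%N.
Proof. by rewrite /lamc big_pred0. Qed.

Lemma weightE t : (0 < N)%N ->
  weight Delta I t z h = (1 - h) ^+ lamtot lam *
    level_weight h position psi_exponent (tlevel t) N (tlevel t N).
Proof.
move=> N0; rewrite /weight /Sym_tvars; congr (_ * _).
have -> : weight_term Delta I z h = partial_term 1 :> (tvars F lam -> F).
  apply: funext => t'; rewrite weight_termE /partial_term /=.
  (* Level 0 has no variables: its sum has one term, with kernel 1. *)
  have no_ord (i : 'I_(lamc lam 0)) : False by case: i; rewrite lamc0.
  rewrite (big_pred1 1%g) => [|s]; last by symmetry; apply/eqP/permP => i; case: (no_ord i).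
  by rewrite level_kernel_no_rows // !mul1r.
rewrite filter_enum_ord_gt0 //.
rewrite (Sym_partial_term_drop (d := N.-1)); last by rewrite addn1 prednK.
by rewrite /partial_term big_pred0 ?mulr1 // => k; rewrite leqNgt ltn_ord.
Qed.
End Weight.
Arguments position [n N lam] I j c.
Arguments tlevel [F n N lam] z t j c.

(** * Positions in ordered partitions *)

(** The source of [eps]: the defect m_{k,j} - m_{k,l} - m_{l,j} is a carry. *)
Lemma floorD_carry (R : archiRealDomainType) (x y : R) :
  exists eps : bool, Num.floor (x + y) = Num.floor x + Num.floor y + eps%:Z.
Proof.
have /andP[x1 x2] := floor_itv x; have /andP[y1 y2] := floor_itv y.
rewrite !intrD in x2 y2.
have [xy|xy] := ltP (x + y) (Num.floor x + Num.floor y + 1)%:~R.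
  exists false; rewrite addr0; apply: floor_def.
  by rewrite xy intrD lerD.
exists true; apply: floor_def; rewrite xy [X in _ < X]intrD !intrD.
by have := ltrD x2 y2; rewrite addrACA !addrA.
Qed.

Lemma sorted_enum_ord (n : nat) (A : {set 'I_n}) :
  sorted (fun i j : 'I_n => (i < j)%N) (enum A).
Proof.
have tr : transitive (fun i j : 'I_n => (i < j)%N) by move=> y x z; exact: ltn_trans.
rewrite /enum_mem; apply: sorted_filter => //; rewrite -enumT.
by rewrite -(sorted_map (f := val) (e' := ltn)) val_enum_ord iota_ltn_sorted.
Qed.

Lemma eq_enum_sorted (n : nat) (A : {set 'I_n}) (s : seq 'I_n) :
  sorted (fun i j : 'I_n => (i < j)%N) s -> s =i A -> enum A = s.
Proof.
move=> s_sorted sA; apply: irr_sorted_eq (sorted_enum_ord A) s_sorted _ => //.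
- by move=> y x z; exact: ltn_trans.
- by move=> x; rewrite ltnn.
- by move=> x; rewrite mem_enum sA.
Qed.

Definition initial_union (n N : nat) (I : 'I_N -> {set 'I_n}) (j : nat) : {set 'I_n} :=
  (\bigcup_(i < N | (i < j)%N) I i)%SET.

Section Partition.
Variables (n N : nat) (lam : 'I_N -> nat) (I : 'I_N -> {set 'I_n.+1}).
Hypothesis hI : is_ordered_partition lam I.

Lemma part_uniq k l x : x \in I k -> x \in I l -> k = l.
Proof.
case: hI => _ dis _ xk xl; apply/eqP; apply: contraTT xl => kl.
by rewrite (disjointFr (dis _ _ kl)).
Qed.

Lemma mem_initial_union k j x : x \in I k -> (x \in initial_union I j) = (k < j)%N.
Proof.
move=> xk; apply/bigcupP/idP => [[i ij xi]|kj]; last by exists k.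
by rewrite (part_uniq xk xi).
Qed.

Lemma card_initial_union j : #|initial_union I j| = lamc lam j.
Proof.
case: hI => cardI dis _; rewrite /initial_union big_mkcond /= -sum1_card.
rewrite partition_disjoint_bigcup /=.
  rewrite [RHS]big_mkcond; apply: eq_bigr => i _.
  by case: ifP => _; rewrite sum1_card ?cardI ?cards0.
move=> i i' ii'; rewrite -setI_eq0.
case: ifP => _; case: ifP => _; rewrite ?(finset.set0I, finset.setI0) //.
by rewrite setI_eq0 dis.
Qed.

Lemma position_mono j : {mono @position n N lam I j : r s / (r < s)%N}.
Proof.
have homo (r s : 'I_(lamc lam j)) : (r < s)%N -> (position I j r < position I j s)%N.
  move=> rs; have sizeE : size (enum (initial_union I j)) = lamc lam j.
    by rewrite -cardE card_initial_union.
  apply: (sorted_ltn_nth (leT := fun i j : 'I_n.+1 => (i < j)%N)) => //.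
  - by move=> y x z; exact: ltn_trans.
  - exact: sorted_enum_ord.
  - by rewrite inE -/(initial_union I j) sizeE.
  - by rewrite inE -/(initial_union I j) sizeE.
move=> r s; case: (ltngtP r s) => [/homo//|/homo sr|/val_inj->]; last exact: ltnn.
by apply/negbTE; rewrite -leqNgt ltnW.
Qed.

Lemma codom_position j x :
  (x \in codom (@position n N lam I j)) = (x \in initial_union I j).
Proof.
have sizeE : size (enum (initial_union I j)) = lamc lam j.
  by rewrite -cardE card_initial_union.
rewrite -[RHS]mem_enum; apply/codomP/idP => [[c ->]|xU].
  by apply: mem_nth; rewrite -/(initial_union I j) sizeE.
have xlt : (index x (enum (initial_union I j)) < lamc lam j)%N.
  by rewrite -sizeE index_mem.
by exists (Ordinal xlt); rewrite /position /ith /= nth_index.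
Qed.

(** At level N every number occurs, so the c-th position is c itself; [position I N] serves to pass
    from the index type of size lambda^(N) to that of [z]. *)
Lemma tlevel_last (F : fieldType) (t : tvars F lam) (z : 'I_n.+1 -> F) :
  tlevel z t N = z \o position I N.
Proof.
apply: funext => c; rewrite /tlevel /tz insubN -?leqNgt //=.
have UT : initial_union I N = [set: 'I_n.+1].
  by case: hI => _ _ <-; apply: eq_bigl => i; rewrite ltn_ord.
have cn : (c < n.+1)%N.
  by apply: leq_trans (ltn_ord c) _; rewrite -card_initial_union UT cardsT card_ord.
rewrite (insubT (fun i => (i < n.+1)%N) cn) /=; congr (z _); apply: val_inj => /=.
rewrite /position /ith -/(initial_union I N) UT.
rewrite (eq_enum_sorted (s := enum 'I_n.+1)) ?nth_enum_ord //.
  by rewrite -(sorted_map (f := val) (e' := ltn)) val_enum_ord iota_ltn_sorted.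
by move=> x; rewrite mem_enum !inE.
Qed.

Lemma psi_exponentE (R : realType) (Delta : set 'rV[R]_N) (k j : 'I_N) x :
  x \in I k -> psi_exponent Delta I j x = - int_char Delta k j.
Proof.
move=> xk; rewrite /psi_exponent valK; case: pickP => [i xi|/(_ k)]; last by rewrite xk.
by rewrite (part_uniq xk xi).
Qed.

End Partition.

Lemma mem_swap_part (n N : nat) (I : 'I_N -> {set 'I_n}) (a b : 'I_n) k x :
  (x \in swap_part a b I k) = (tperm a b x \in I k).
Proof. by rewrite /swap_part -{1}[x](tpermK a b) mem_imset //; exact: perm_inj. Qed.

(** * Effect of the exchange on positions and exponents *)

Section Swap.
Variables (n N : nat) (lam : 'I_N -> nat) (I : 'I_N -> {set 'I_n.+1}) (a b : 'I_n.+1).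

Lemma swap_partK : swap_part a b (swap_part a b I) = I.
Proof. by apply: funext => k; apply/setP => x; rewrite !mem_swap_part tpermK. Qed.

Lemma swap_part_partition :
  is_ordered_partition lam I -> is_ordered_partition lam (swap_part a b I).
Proof.
case=> cardI dis cov; split.
- by move=> k; rewrite card_imset //; exact: perm_inj.
- move=> k l kl; rewrite -setI_eq0; apply/eqP/setP => x.
  rewrite finset.in_setI finset.in_set0 !mem_swap_part.
  by apply/negbTE/negP => /andP[xk]; rewrite (disjointFr (dis _ _ kl) xk).
apply/setP => x; rewrite inE; apply/bigcupP.
have : tperm a b x \in \bigcup_k I k by rewrite cov inE.
by case/bigcupP => k _ xk; exists k; rewrite ?mem_swap_part.
Qed.

Lemma mem_initial_union_swap j x :
  (x \in initial_union (swap_part a b I) j) = (tperm a b x \in initial_union I j).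
Proof.
by apply/bigcupP/bigcupP => -[i ij xi]; exists i => //; rewrite mem_swap_part in xi *.
Qed.

Lemma psi_exponent_swap (R : realType) (Delta : set 'rV[R]_N) j x :
  psi_exponent Delta (swap_part a b I) j x = psi_exponent Delta I j (tperm a b x).
Proof.
rewrite /psi_exponent; case: insub => // k.
by under eq_pick => i do rewrite mem_swap_part.
Qed.

Hypothesis hI : is_ordered_partition lam I.
Hypothesis ab : b = a.+1 :> nat.

Lemma position_swap_both j : a \in initial_union I j -> b \in initial_union I j ->
  @position n N lam (swap_part a b I) j = position I j.
Proof.
move=> aU bU; apply: funext => c; rewrite /position /ith.
rewrite -/(initial_union I j) -/(initial_union (swap_part a b I) j).
suff -> : initial_union (swap_part a b I) j = initial_union I j by [].
apply/setP => x; rewrite mem_initial_union_swap.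
by case: tpermP => // ->; rewrite aU bU.
Qed.

(** Without b in the union, replacing a by a + 1 keeps the enumeration increasing, so it is the
    enumeration of the new union. *)
Lemma position_swap_notin j : b \notin initial_union I j ->
  @position n N lam (swap_part a b I) j = tperm a b \o position I j.
Proof.
move=> bU; apply: funext => c; rewrite /position /ith /=.
rewrite -/(initial_union I j) -/(initial_union (swap_part a b I) j).
rewrite (eq_enum_sorted (s := map (tperm a b) (enum (initial_union I j)))).
- by rewrite (nth_map ord0) // -cardE (card_initial_union hI).
- apply: (homo_sorted_in (P := mem (initial_union I j)) (e := fun i j : 'I_n.+1 => (i < j)%N)).
  + move=> x y xU yU.
    have xb : x != b by apply: contraNneq bU => <-.
    have yb : y != b by apply: contraNneq bU => <-.
    case: tpermP => [->|E|/eqP xa _]; last 1 first.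
    * rewrite -val_eqE /= in xa; case: tpermP => [->|E|//]; last by rewrite E eqxx in yb.
      by rewrite ab => xa'; apply: leqW.
    * case: tpermP => [->|E|/eqP ya _]; rewrite ?ltnn //; first by rewrite E eqxx in yb.
      by rewrite -val_eqE /= ab in yb; rewrite ab; lia.
    * by rewrite E eqxx in xb.
  + by apply/allP => x; rewrite mem_enum.
  + exact: sorted_enum_ord.
- move=> x; rewrite mem_initial_union_swap -{1}[x](tpermK a b) mem_map ?mem_enum //.
  exact: perm_inj.
Qed.
End Swap.

(** * The exchange relations *)

Section Main.
Variables (R : realType) (F : fieldType) (n N : nat) (lam : 'I_N -> nat).
Variables (Delta : set 'rV[R]_N) (a b : 'I_n.+1).
Variables (t : tvars F lam) (z : 'I_n.+1 -> F) (h : F).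
Arguments t : clear implicits.
Hypothesis hN : (0 < N)%N.
Hypothesis ab : b = a.+1 :> nat.
Hypothesis t0 : forall p c, t p c != 0.
Hypothesis t_inj : forall p, injective (t p).
Hypothesis z0 : forall i, z i != 0.

Lemma tlevel_swap_var (j : nat) : (j < N)%N ->
  tlevel (lam := lam) (swap_var a b z) t j = tlevel z t j.
Proof.
move=> jN; apply: funext => c; rewrite /tlevel /tz.
by case: insubP => //; rewrite jN.
Qed.

Lemma tlevel_neq0 (j : nat) c : (j < N)%N -> tlevel (lam := lam) z t j c != 0.
Proof. by move=> jN; rewrite (tlevel_ord z t (Ordinal jN)). Qed.

Lemma tlevel_inj (j : nat) : (j < N)%N -> injective (tlevel (lam := lam) z t j).
Proof. by move=> jN; rewrite (tlevel_ord z t (Ordinal jN)); exact: (@t_inj (Ordinal jN)). Qed.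

Section Part.
Variables (I : 'I_N -> {set 'I_n.+1}) (k l : 'I_N).
Hypotheses (hI : is_ordered_partition lam I) (aIk : a \in I k) (bIl : b \in I l).

Lemma codom_position_in (x : 'I_n.+1) (i : 'I_N) (j : nat) : x \in I i ->
  (x \in codom (@position n N lam I j)) = (i < j)%N.
Proof. by move=> xi; rewrite (codom_position hI) (mem_initial_union hI _ xi). Qed.

(** Levels below N do not see [z]; at level N the exchange in [z] permutes the positions of a and
    b. *)
Lemma weight_swap_var (q1 q2 : 'I_(lamc lam N)) :
  position I N q1 = a -> position I N q2 = b ->
  weight Delta I t (swap_var a b z) h = (1 - h) ^+ lamtot lam *
    level_weight h (@position n N lam I) (psi_exponent Delta I) (tlevel z t) N
      (tlevel z t N \o tperm q1 q2).
Proof.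
move=> pq1 pq2; rewrite weightE //; congr (_ * _).
rewrite (level_weight_ext _ _ _ _ tlevel_swap_var); congr level_weight.
apply: funext => c; rewrite !(tlevel_last hI) /= /swap_var.
by rewrite (inj_tperm _ _ _ (mono_ord_inj (@position_mono _ _ _ _ hI N))) pq1 pq2.
Qed.

Lemma last_position (x : 'I_n.+1) : exists q, position (lam := lam) I N q = x.
Proof.
have : x \in codom (@position n N lam I N).
  case: (hI) => _ _ cov; have : x \in (\bigcup_i I i)%SET by rewrite cov finset.in_setT.
  by case/bigcupP => i _ /codom_position_in ->; exact: ltn_ord.
by case/codomP => q ->; exists q.
Qed.

Lemma weight_swap_var_eq : k = l ->
  weight Delta I t (swap_var a b z) h = weight Delta I t z h.
Proof.
move=> kl; have [q1 pq1] := last_position a; have [q2 pq2] := last_position b.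
rewrite (weight_swap_var pq1 pq2) weightE //; congr (_ * _).
apply: (level_weight_sym (N := N) (k := k) (l := l) _ ab) pq1 pq2 _ => //.
- by move=> j _; exact: position_mono hI j.
- by move=> j _; exact: codom_position_in.
- by move=> j _; exact: codom_position_in.
- by move=> j r; exact: tlevel_neq0.
- exact: tlevel_inj.
- by rewrite kl.
- move=> j _ jN; rewrite !(psi_exponentE hI Delta (Ordinal jN) (k := k)) //.
  by rewrite kl.
- by move=> c; rewrite (tlevel_last hI); exact: z0.
Qed.

Lemma weight_swap_part_lt : z a != z b -> (k < l)%N ->
  weight Delta (swap_part a b I) t z h =
    coef_swap h (z a / z b) * weight Delta I t (swap_var a b z) h
    + coef_id h (int_char Delta k l) (z a / z b) * weight Delta I t z h.
Proof.
move=> zab kl; have [q1 pq1] := last_position a; have [q2 pq2] := last_position b.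
rewrite (weight_swap_var pq1 pq2) !weightE //.
rewrite !(mulrCA _ ((1 - h) ^+ _)) -mulrDr; congr (_ * _).
have zq1 : tlevel z t N q1 = z a by rewrite (tlevel_last hI) /= pq1.
have zq2 : tlevel z t N q2 = z b by rewrite (tlevel_last hI) /= pq2.
rewrite -zq1 -zq2; apply: (level_weight_exchange (N := N) (k := k) (l := l) _ ab) => //.
- by move=> j _; exact: position_mono hI j.
- by move=> j _; exact: codom_position_in.
- by move=> j _; exact: codom_position_in.
- by move=> j r; exact: tlevel_neq0.
- exact: tlevel_inj.
- move=> j jl _; apply: (position_swap_notin hI ab).
  by rewrite (mem_initial_union hI _ bIl) -leqNgt.
- move=> j lj _; apply: position_swap_both.
    by rewrite (mem_initial_union hI _ aIk) (ltn_trans kl).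
  by rewrite (mem_initial_union hI _ bIl).
- by move=> j r; rewrite psi_exponent_swap.
- by rewrite (psi_exponentE hI Delta l aIk).
(* All three characteristics are floors at the same point [nu], and nu_j - nu_k = (nu_l - nu_k) +
   (nu_j - nu_l). *)
- move=> j lj jN; rewrite (psi_exponentE hI Delta (Ordinal jN) aIk).
  rewrite (psi_exponentE hI Delta (Ordinal jN) bIl) !opprK /int_char.
  set nu := xget _ _.
  have [eps epsE] := floorD_carry (nu ord0 l - nu ord0 k) (nu ord0 (Ordinal jN) - nu ord0 l).
  by exists eps; rewrite -epsE; congr Num.floor; ring.
- by move=> c; rewrite (tlevel_last hI); exact: z0.
- by rewrite zq1 zq2.
Qed.
End Part.
End Main.

Lemma swap_varK (F : Type) (n : nat) (a b : 'I_n) (z : 'I_n -> F) :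
  swap_var a b (swap_var a b z) = z.
Proof. by apply: funext => i; rewrite /swap_var tpermK. Qed.

Theorem theorem3p2 (R : realType) (F : fieldType) (n N : nat) (hN : (0 < N)%N)
    (lam : 'I_N -> nat) (hlam : (\sum_(k < N) lam k)%N = n.+1)
    (Delta : set 'rV[R]_N) (hDelta : is_alcove Delta)
    (I : 'I_N -> {set 'I_n.+1}) (hI : is_ordered_partition lam I)
    (a b : 'I_n.+1) (hab : b = a.+1 :> nat)
    (k l : 'I_N) (hk : a \in I k) (hl : b \in I l)
    (t : tvars F lam) (z : 'I_n.+1 -> F) (h : F)
    (ht0 : forall p c, t p c != 0) (ht : forall p, injective (t p))
    (hz0 : forall i, z i != 0) (hz : z a != z b) (hh : h != 0) :
  [/\ k = l ->
        weight Delta I t (swap_var a b z) h = weight Delta I t z h,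
      (k < l)%N ->
        weight Delta (swap_part a b I) t z h =
          (1 - h * (z a / z b)) / (1 - z a / z b)
            * weight Delta I t (swap_var a b z) h
          + (h - 1) * ((z a / z b) ^ (int_char Delta k l + 1)
                         / (1 - z a / z b))
            * weight Delta I t z h
    & (l < k)%N ->
        weight Delta (swap_part a b I) t z h =
          (1 - h^-1 * (z b / z a)) / (1 - z b / z a)
            * weight Delta I t (swap_var a b z) h
          + (h^-1 - 1) * ((z b / z a) ^ (int_char Delta l k + 1)
                            / (1 - z b / z a))
            * weight Delta I t z h].
Proof.
split; first exact: weight_swap_var_eq hk hl.
  exact: weight_swap_part_lt hk hl hz.
move=> lk; have hJ := swap_part_partition a b hI.
have aJ : a \in swap_part a b I l by rewrite mem_swap_part tpermL.
have bJ : b \in swap_part a b I k by rewrite mem_swap_part tpermR.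
have z'0 i : swap_var a b z i != 0 by exact: hz0.
have z'a : swap_var a b z a = z b by rewrite /swap_var tpermL.
have z'b : swap_var a b z b = z a by rewrite /swap_var tpermR.
have z'ab : swap_var a b z a != swap_var a b z b by rewrite z'a z'b eq_sym.
(* With J = s(I), these express W_I(z) and W_I(s(z)) through W_J(z) and W_J(s(z)), because s(J) = I
   and s(s(z)) = z. *)
have E1 := weight_swap_part_lt Delta h hN hab ht0 ht hz0 hJ aJ bJ hz lk.
have E2 := weight_swap_part_lt Delta h hN hab ht0 ht z'0 hJ aJ bJ z'ab lk.
move: E1 E2; rewrite swap_partK swap_varK z'a z'b.
move: (weight _ _ _ _ _) (weight _ _ _ _ _) (weight _ _ _ _ _) (weight _ _ _ _ _) => w1 w2 w3 w4 -> ->.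
rewrite /coef_swap /coef_id !expfzDr ?mulf_neq0 ?invr_eq0 // !expr1z !expfzMl -!expfV.
have A0 := expfz_neq0 (int_char Delta l k) (hz0 a).
have B0 := expfz_neq0 (int_char Delta l k) (hz0 b).
move: (z a ^ _) (z b ^ _) A0 B0 => A B A0 B0.
have ba : z b - z a != 0 by rewrite subr_eq0 eq_sym.
have ba' : z a - z b != 0 by rewrite subr_eq0.
(* After substitution the coefficient of W_J(s(z)) cancels and that of W_J(z) is 1. *)
by field; rewrite ?A0 ?B0 ?hz0 ?hh ?ba ?ba'.
Qed.
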